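(* Let $1\le j\le n$ and let $p(x)=x^n+a_{n-j}x^{n-j}+a_{n-j-1}x^{n-j-1}+\cdots+a_1x+a_0$ be a polynomial with real coefficients and $a_{n-j}\neq 0$. Associate to it the linear difference equation $$x_{k+1}=F(x_k,x_{k-1},\ldots,x_{k-n+1})=-a_{n-j}x_{k-j+1}-a_{n-j-1}x_{k-j}-\cdots-a_0x_{k-n+1}.$$ Define the iterated system by substituting $F$ for the first variable with nonzero coefficient (i.e. $x_{k-j+1}$): $$y_{k+1}=-a_{n-j}F(y_{k-j},\ldots,y_{k-n-j+1})-a_{n-j-1}y_{k-j}-\cdots-a_0y_{k-n+1}=:b_jy_{k-j}+\cdots+b_{j+n-1}y_{k-j-n+1},$$ where $b_i$ is the total coefficient of $y_{k-i}$ after collecting like terms. Then $$\sum_{i=j}^{j+n-1}|b_i|<1\ \Longrightarrow\ p(x)\text{ is Schur stable}.$$ The same result holds if one substitutes in any other variable: if, for some $j-1\le l\le n-1$, the variable $x_{k-l}$ in the difference equation is replaced by $F(y_{k-l-1},\ldots,y_{k-l-n})$ (all other $x_{k-i}$ being renamed $y_{k-i}$) and the sum of the absolute values of the coefficients of the resulting linear expression, after collecting like terms, is less than $1$, then $p(x)$ is Schur stable.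
   Context: A polynomial is Schur stable if all of its complex zeros lie in the open unit disk $\mathbb{D}=\{z\in\mathbb{C}:|z|<1\}$. Here $F:\mathbb{R}^n\to\mathbb{R}$ is the linear function $F(u_1,\ldots,u_n)=-\sum_{i=j}^{n}a_{n-i}u_i$, so that $u_i$ stands for $x_{k-i+1}$. *)

(* Defs.v *)
From mathcomp Require Import all_boot all_order all_algebra.
From mathcomp Require Import reals.
From mathcomp Require Import complex.

Set Implicit Arguments.
Unset Strict Implicit.
Unset Printing Implicit Defensive.

Import Order.TTheory GRing.Theory Num.Theory.
Local Open Scope ring_scope.

Section Definitions.
Variable R : realType.

(* The norm of R[i] takes its values in R[i], with the order for which
   x < y means that y - x is a positive real. *)
Definition schur_stable (q : {poly R[i]}) : Prop :=
  forall z : R[i], root q z -> `|z| < 1.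

Definition poly_complex (p : {poly R}) : {poly R[i]} :=
  map_poly (real_complex R) p.

(* x^n + a_(n-j) x^(n-j) + ... + a_1 x + a_0; only a 0, ..., a (n - j) are
   used. *)
Definition gap_poly (n j : nat) (a : nat -> R) : {poly R} :=
  'X^n + \poly_(i < (n - j).+1) a i.

(* F(u_1, ..., u_n) = - sum_(i = j)^n a_(n-i) u_i; the 1-based coordinate
   u_(i+1) is the entry u 0 i of the row vector. *)
Definition linF (n j : nat) (a : nat -> R) (u : 'rV[R]_n) : R :=
  - \sum_(i < n | (j <= i.+1)%N) a (n - i.+1)%N * u 0 i.

(* (x_k, x_(k-1), ..., x_(k-n+1)) *)
Definition window (n : nat) (x : int -> R) (k : int) : 'rV[R]_n :=
  \row_(i < n) x (k - i%:Z).

(* The right-hand side F(y_k, ..., y_(k-n+1)) of the difference equation in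
   which the variable of delay l has been replaced by
   F(y_(k-l-1), ..., y_(k-l-n)). *)
Definition iterated_rhs (n j : nat) (a : nat -> R) (l : nat)
    (y : int -> R) (k : int) : R :=
  linF j a (\row_(i < n) if i == l :> nat then
                           linF j a (window n y (k - l%:Z - 1))
                         else y (k - i%:Z)).

(* After collecting like terms, the iterated right-hand side is
   sum_(r <= i < s) b_i y_(k-i).  Since this is an identity in a free sequence
   y, it determines b_i for r <= i < s. *)
Definition collected (n j : nat) (a : nat -> R) (l r s : nat)
    (b : nat -> R) : Prop :=
  forall (y : int -> R) (k : int),
    iterated_rhs n j a l y k = \sum_(r <= i < s) b i * y (k - i%:Z).

End Definitions.

(* Main.v *)
Require Import Defs.
From mathcomp Require Import all_boot all_order all_algebra.
From mathcomp Require Import reals.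
From mathcomp Require Import complex.

(** A solution of the difference equation over the integers also solves the
    iterated equation, because replacing x_(k-l) by
    F(x_(k-l-1), ..., x_(k-l-n)) does not change its value.  Hence every root
    z <> 0 of p, through the geometric solution m |-> z^m
    ([geometric_recurrence]), also satisfies the characteristic equation of
    the iterated system, z = sum_i b_i z^(-i)
    ([collected_characteristic]).  If 1 <= |z|, the triangle
    inequality bounds the right-hand side by sum_i |b_i| < 1, since the delays
    i are nonnegative; this contradicts |z| >= 1.

    The iterated system is stated for real sequences while z is complex; the
    real and imaginary parts of the geometric solution are real solutions, and
    the two real identities recombine into the complex one.

    Both parts of the theorem are instances of [collected_schur_stable]: they
    differ only in the replaced variable and in the range of delays over which
    like terms are collected. *)

Import Order.TTheory GRing.Theory Num.Theory.
Local Open Scope ring_scope.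

(** Along a solution, the inner F evaluates to y (k - l), the very entry of the
    window that it replaces. *)
Lemma iterated_rhs_solution (R : realType) (n j : nat) (a : nat -> R)
    (l : nat) (y : int -> R) :
  (forall m : int, y (m + 1) = linF j a (window n y m)) ->
  forall k : int, iterated_rhs n j a l y k = y (k + 1).
Proof.
move=> ysol k; rewrite ysol; congr linF; apply/rowP => i; rewrite !mxE.
by case: eqP => [->|//]; rewrite -ysol subrK.
Qed.

(** This is p(z) z^(m+1-n) = 0, read from the highest power down. *)
Lemma geometric_recurrence (R : realType) (n j : nat) (a : nat -> R)
    (z : R[i]) (m : int) :
  (1 <= j <= n)%N -> z != 0 ->
  root (poly_complex (gap_poly n j a)) z ->
  z ^ (m + 1) =
    - \sum_(i < n | (j <= i.+1)%N) (a (n - i.+1)%N)%:C%C * z ^ (m - i%:Z).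
Proof.
case/andP=> j_gt0 le_jn z_neq0 /rootP.
rewrite /poly_complex /gap_poly rmorphD /= map_polyXn hornerD hornerXn.
move/eqP; rewrite addr_eq0 => /eqP zn.
have -> : z ^ (m + 1) = z ^+ n * z ^ (m + 1 - n%:Z).
  by rewrite exprnP -expfzDr // addrCA subrr addr0.
rewrite zn mulNr; congr (- _).
rewrite (@horner_coef_wide _ (n - j).+1); last first.
  by rewrite (leq_trans (size_poly _ _)) ?size_poly.
rewrite mulr_suml (big_ord_widen n
  (fun i => (map_poly (real_complex R) (\poly_(i < (n - j).+1) a i))`_i
     * z ^+ i * z ^ (m + 1 - n%:Z))); last first.
  by rewrite -subSn // leq_subLR -add1n leq_add2r.
rewrite (reindex_inj rev_ord_inj) /=; apply: eq_big => [i|i lt_i].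
  by rewrite ltnS leq_sub2lE.
rewrite coef_map coef_poly /= lt_i exprnP -mulrA -expfzDr //.
congr (_ * z ^ _); rewrite -subzn // -add1n PoszD.
by rewrite addrC addrA subrK addrKA.
Qed.

(** A real-linear functional turns complex solutions of a recurrence with real
    coefficients into real ones; it will be the real or the imaginary part. *)
Lemma collected_functional (R : realType) (n j : nat) (a : nat -> R)
    (l r s : nat) (b : nat -> R) (z : R[i]) (phi : R[i] -> R) :
  phi 0 = 0 -> {morph phi : x y / x + y} ->
  (forall c x, phi (c%:C%C * x) = c * phi x) ->
  (1 <= j <= n)%N -> z != 0 ->
  root (poly_complex (gap_poly n j a)) z ->
  collected n j a l r s b ->
  phi z = phi (\sum_(r <= i < s) (b i)%:C%C * z ^ (- i%:Z)).
Proof.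
move=> phi0 phiD phiZ hj z_neq0 root_z /(_ (fun m => phi (z ^ m)) 0).
rewrite iterated_rhs_solution => [|m]; last first.
  rewrite (@geometric_recurrence R n j a) // /linF.
  rewrite -mulN1r -(rmorphN1 (real_complex R)) phiZ mulN1r; congr (- _).
  by rewrite (big_morph phi phiD phi0); apply: eq_bigr => i _; rewrite phiZ mxE.
rewrite add0r expr1z => ->; rewrite (big_morph phi phiD phi0).
by apply: eq_bigr => i _; rewrite phiZ sub0r.
Qed.

Lemma collected_characteristic (R : realType) (n j : nat) (a : nat -> R)
    (l r s : nat) (b : nat -> R) (z : R[i]) :
  (1 <= j <= n)%N -> z != 0 ->
  root (poly_complex (gap_poly n j a)) z ->
  collected n j a l r s b ->
  z = \sum_(r <= i < s) (b i)%:C%C * z ^ (- i%:Z).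
Proof.
move=> hj z_neq0 root_z coll.
apply/eqP; rewrite eq_complex; apply/andP; split; apply/eqP.
- apply: (@collected_functional R n j a l r s b z (@complex.Re R)) => //.
  + by case=> [? ?] [? ?].
  + by move=> c [? ?] /=; rewrite mul0r subr0.
- apply: (@collected_functional R n j a l r s b z (@complex.Im R)) => //.
  + by case=> [? ?] [? ?].
  + by move=> c [? ?] /=; rewrite mul0r addr0.
Qed.

Lemma collected_schur_stable (R : realType) (n j : nat) (a : nat -> R)
    (l r s : nat) (b : nat -> R) :
  (1 <= j <= n)%N -> collected n j a l r s b ->
  \sum_(r <= i < s) `|b i| < 1 ->
  schur_stable (poly_complex (gap_poly n j a)).
Proof.
move=> hj coll sum_lt1 z root_z.
rewrite real_ltNge ?normr_real ?real1 //; apply/negP => z_ge1.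
have z_neq0 : z != 0 by rewrite -normr_gt0 (lt_le_trans ltr01).
suff : `|z| < 1 by move=> /(le_lt_trans z_ge1); rewrite ltxx.
rewrite (@collected_characteristic R n j a l r s b z) //.
have sumC_lt1 : \sum_(r <= i < s) (`|b i|)%:C%C < 1 :> R[i].
  by rewrite -(rmorph_sum (real_complex R)) -(rmorph1 (real_complex R)) ltcR.
apply: le_lt_trans sumC_lt1; apply: le_trans (ler_norm_sum _ _ _) _.
apply: ler_sum => i _; rewrite normrM -exprnN normfV normrX.
have -> : `|(b i)%:C%C| = (`|b i|)%:C%C :> R[i].
  by rewrite normc_def /= expr0n addr0 sqrtr_sqr.
rewrite -[leRHS]mulr1 ler_wpM2l ?lecR //.
by rewrite invf_le1 ?exprn_ege1 // exprn_gt0 ?normr_gt0.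
Qed.

Theorem theorem5p2 (R : realType) (n j : nat) (a : nat -> R)
    (hj : (1 <= j <= n)%N) (ha : a (n - j)%N != 0) :
  (forall b : nat -> R,
      collected n j a (j - 1) j (j + n) b ->
      \sum_(j <= i < j + n) `|b i| < 1 ->
      schur_stable (poly_complex (gap_poly n j a)))
  /\
  (forall (l : nat) (b : nat -> R),
      (j - 1 <= l <= n - 1)%N ->
      collected n j a l (j - 1) (l + n).+1 b ->
      \sum_(j - 1 <= i < (l + n).+1) `|b i| < 1 ->
      schur_stable (poly_complex (gap_poly n j a))).
Proof.
by split=> [b|l b _]; apply: collected_schur_stable.
Qed.
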